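(* Let $m_1,m_2,n,k,l$ be integers with $0\leq m_1\leq m_2\leq n$ and $0\leq l\leq k\leq n$. Then $$\sum_{i=m_1-l}^{m_2-l}\binom{n-k}{i}=\sum_{i_1=0}^{l}\sum_{i_2=0}^{k-l}\sum_{i_3=m_1-i_2}^{m_2-i_2}(-1)^{i_1+i_2}\binom{l}{i_1}\binom{k-l}{i_2}\binom{n-i_1-i_2}{i_3}.$$
   Context: For an integer $a\geq 0$ and an integer $b$, $\binom{a}{b}$ is the usual binomial coefficient, with $\binom{a}{b}=0$ if $b<0$ or $b>a$. Summation indices run over integers and may be negative. *)

(* Defs.v *)
From HB Require Import structures.
From mathcomp Require Import all_boot all_order all_algebra.
From mathcomp Require Import zify.
Set Implicit Arguments.
Unset Strict Implicit.
Unset Printing Implicit Defensive.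
Import Order.TTheory GRing.Theory Num.Theory.
Local Open Scope ring_scope.

(* Only a >= 0 is meaningful; for a < 0 the value 0 is a dummy. *)
Definition binz (a b : int) : int :=
  match a, b with
  | Posz a', Posz b' => 'C(a', b')%:Z
  | _, _ => 0
  end.

(* a, a + 1, ..., b, both bounds included; empty when b < a. *)
Definition zrange (a b : int) : seq int :=
  if a <= b then [seq a + j%:Z | j <- iota 0 `|b - a|.+1] else [::].

Lemma zrange_uniq (a b : int) : uniq (zrange a b).
Proof.
rewrite /zrange; case: ifP => // _.
by rewrite map_inj_uniq ?iota_uniq // => i j /addrI [].
Qed.

Lemma mem_zrange (a b i : int) : (i \in zrange a b) = (a <= i <= b).
Proof.
rewrite /zrange; case: ifP => leab; last by rewrite in_nil; lia.
apply/mapP/idP => [[j] | leaib]; first by rewrite mem_iota => ? ->; lia.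
by exists `|i - a|%N; rewrite ?mem_iota; lia.
Qed.

(* Main.v *)
Require Import Defs.
From mathcomp Require Import all_boot all_order all_algebra.
From mathcomp Require Import zify ring.
Import Order.TTheory GRing.Theory Num.Theory.
Local Open Scope ring_scope.

(** The identity holds for each m in [m1, m2] separately: the summands are the
    coefficients of X^m on the two sides of
      X^l (1+X)^(n-k) = ((1+X) - 1)^l ((1+X) - X)^(k-l) (1+X)^(n-k),
    where the two differences on the right are expanded by the binomial
    theorem. *)

Lemma zrange_subr (a b c : int) :
  zrange (a - c) (b - c) = [seq i - c | i <- zrange a b].
Proof.
rewrite /zrange lerD2r; case: ifP => // _.
by rewrite -map_comp opprB addrA subrK; apply: eq_map => j /=; rewrite addrAC.
Qed.

Lemma big_zrange0 (l : nat) (F : int -> int) :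
  \sum_(i <- zrange 0 l%:Z) F i = \sum_(i < l.+1) F i%:Z.
Proof.
rewrite /zrange big_map subr0 absz_nat -[iota _ _]/(index_iota 0 l.+1).
by rewrite big_mkord; apply: eq_bigr => i _; rewrite add0r.
Qed.

Lemma binz_coef (a i m : nat) :
  binz a%:Z (m%:Z - i%:Z) = ('X^i * (1 + 'X) ^+ a : {poly int})`_m.
Proof.
have -> : 1 + 'X = 'X + 1 :> {poly int} by rewrite addrC.
have -> : ('X + 1) ^+ a = \poly_(j < a.+1) 'C(a, j)%:Z :> {poly int}.
  rewrite poly_def exprD1n; apply: eq_bigr => j _.
  by rewrite -scaler_nat natz.
rewrite coefXnM coef_poly; case: ltnP => [lt_mi | le_im].
  (* Below degree [i] the coefficient vanishes; the [Negz] form lets [binz] compute to its default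
     0. *)
  by have -> : m%:Z - i%:Z = Negz (i - m).-1 by lia.
by rewrite subzn //=; case: ltnP => // ?; rewrite bin_small.
Qed.

(** The identity for a single m, with [d] for k - l and [r] for n - k, so that n is [l + d + r]. *)
Lemma binz_alternating (l d r m : nat) :
  binz r%:Z (m%:Z - l%:Z) =
  \sum_(i1 < l.+1) \sum_(i2 < d.+1)
    (-1) ^ (i1%:Z + i2%:Z) * binz l%:Z i1%:Z * binz d%:Z i2%:Z
    * binz ((l + d + r)%N%:Z - i1%:Z - i2%:Z) (m%:Z - i2%:Z).
Proof.
pose p : {poly int} := 1 + 'X.
have expand : 'X^l * p ^+ r = (p - 1) ^+ l * (p - 'X) ^+ d * p ^+ r.
  by rewrite {2}/p addrAC subrr add0r /p addrK expr1n mulr1.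
rewrite binz_coef -/p expand !exprBn !mulr_suml coef_sum.
apply: eq_bigr => i1 _; rewrite mulr_sumr mulr_suml coef_sum.
apply: eq_bigr => i2 _.
have le1 := ltn_ord i1; have le2 := ltn_ord i2.
(* The total exponent of 1 + X in the term (i1, i2); the bounds [le1] and [le2] make the truncated
   subtractions exact. *)
have -> : (l + d + r)%N%:Z - i1%:Z - i2%:Z
          = ((l - i1) + (d - i2) + r)%N%:Z by lia.
rewrite binz_coef -coefZ.
(* Naming polyseq keeps the goal in {poly int}: congr would otherwise descend
   to an equation between coefficient sequences, on which ring fails. *)
congr (polyseq _)`_m.
rewrite -mul_polyC -!exprnP !exprD !rmorphM !rmorphXn rmorphN1 /=.
rewrite -!natz !rmorph_nat -/p expr1n.
ring.
Qed.

Theorem proposition2p2 (m1 m2 n k l : int)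
    (hm : 0 <= m1 /\ m1 <= m2 /\ m2 <= n)
    (hkl : 0 <= l /\ l <= k /\ k <= n) :
  \sum_(i <- zrange (m1 - l) (m2 - l)) binz (n - k) i =
  \sum_(i1 <- zrange 0 l)
    \sum_(i2 <- zrange 0 (k - l))
      \sum_(i3 <- zrange (m1 - i2) (m2 - i2))
        (-1) ^ (i1 + i2) * binz l i1 * binz (k - l) i2 * binz (n - i1 - i2) i3.
Proof.
case: hm => m1_ge0 _; case: hkl => l_ge0 [le_lk le_kn].
(* Substituting i3 = m - i2 makes the inner range independent of i2, so the sum over m can move
   outermost. *)
under [RHS]eq_bigr => i1 _.
  under eq_bigr => i2 _ do rewrite zrange_subr big_map.
  rewrite exchange_big; over.
rewrite exchange_big zrange_subr big_map.
apply: eq_big_seq => m; rewrite mem_zrange => /andP[le_m1m _].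
have [m' ->] : exists m' : nat, m = m' by exists `|m|%N; lia.
have [r Dr] : exists r : nat, n - k = r by exists `|n - k|%N; lia.
have [d Dd] : exists d : nat, k - l = d by exists `|k - l|%N; lia.
have [l' Dl] : exists l' : nat, l = l' by exists `|l|%N; lia.
rewrite Dr Dd (_ : n = (l' + d + r)%N); last by lia.
rewrite Dl (binz_alternating _ d) (big_zrange0 l').
by apply: eq_bigr => i1 _; rewrite (big_zrange0 d).
Qed.
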